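(* If $T$ is a threshold graph, then its domination polynomial $D(T,x)$ has a unimodal coefficient sequence.
   Context: A set $S\subseteq V(G)$ is dominating if every vertex is in $S$ or adjacent to a vertex of $S$; the domination polynomial is $D(G,x)=\sum_{k=0}^n d_k(G)x^k$ where $d_k(G)$ is the number of dominating sets of size $k$. A graph $T$ on $n$ vertices is a threshold graph if there is an ordering $v_1,\dots,v_n$ of its vertices such that each $v_j$ is either isolated or adjacent to all of $v_1,\dots,v_{j-1}$ in the induced subgraph on $\{v_1,\dots,v_j\}$. A sequence $c_0,\dots,c_N$ is unimodal if there is an index $j$ with $c_0\le\cdots\le c_j\ge\cdots\ge c_N$. *)

(* Defs.v *)
From mathcomp Require Import all_boot all_order all_algebra.

Set Implicit Arguments.
Unset Strict Implicit.
Unset Printing Implicit Defensive.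

Import Order.TTheory GRing.Theory Num.Theory.
Local Open Scope ring_scope.

(* A finite simple graph is a finite vertex type with a symmetric, irreflexive
   adjacency relation; the last two properties are hypotheses of the theorem. *)

Definition dominating (V : finType) (e : rel V) (S : {set V}) : bool :=
  [forall v, (v \in S) || [exists u in S, e v u]].

Definition num_dominating (V : finType) (e : rel V) (k : nat) : nat :=
  #|[set S : {set V} | dominating e S & #|S| == k]|.

Definition domination_poly (V : finType) (e : rel V) : {poly int} :=
  \sum_(k < #|V|.+1) (num_dominating e k)%:Z *: 'X^k.

Definition isolated_in (V : finType) (e : rel V) (A : {set V}) (x : V) : Prop :=
  forall y, y \in A -> ~~ e x y.

(* The vertices are ordered v 0, ..., v (n - 1), where n = #|V|. *)
Definition threshold (V : finType) (e : rel V) : Prop :=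
  exists v : 'I_#|V| -> V,
    bijective v /\
    forall j : 'I_#|V|,
      isolated_in e [set v i | i : 'I_#|V| & (i <= j)%N] (v j) \/
      (forall i : 'I_#|V|, (i < j)%N -> e (v j) (v i)).

(* Unimodality of the finite sequence c 0, ..., c N; values of c beyond N are
   ignored. *)
Definition unimodal (N : nat) (c : nat -> int) : Prop :=
  exists j : nat,
    [/\ (j <= N)%N,
        forall i, (i < j)%N -> c i <= c i.+1 &
        forall i, (j <= i)%N -> (i < N)%N -> c i.+1 <= c i].

(* Main.v *)
(* Adding an isolated vertex to a graph on n vertices turns its domination
   polynomial D into x D; adding a vertex adjacent to all of them, for n > 0,
   turns D into D + x (1 + x)^n.  Writing d_k for the coefficients, one carries
   along these steps the invariants d_k <= C(n, k),
   (n - k) d_k <= (k + 1) d_(k+1) and d_(k+1) - d_k <= Cat(n - k), where Cat(t)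
   is the t-th Catalan number.  A shift preserves unimodality outright.  For
   D + x (1 + x)^n, the second invariant shows that the coefficients increase
   while 2 k <= n, and for 2 k >= n + 2 the decrement C(n, k - 1) - C(n, k) is
   a ballot number that is at least Cat(n - k), hence the coefficients decrease.
   At most one step, at 2 k = n + 1, has undetermined sign, which is harmless. *)

Require Import Defs.
From mathcomp Require Import all_boot all_order all_algebra.
From mathcomp Require Import zify.

Set Implicit Arguments.
Unset Strict Implicit.
Unset Printing Implicit Defensive.

Import Order.TTheory GRing.Theory Num.Theory.
Local Open Scope ring_scope.

(** * Ballot numbers and Catalan bounds *)

(* For b <= a + 1, the number of standard Young tableaux of shape (a, b):
   'C(a + b, a.+1) is 'C(a + b, b - 1), written so that b = 0 is not special. *)
Definition ballot (a b : nat) : int := 'C(a + b, b)%:Z - 'C(a + b, a.+1)%:Z.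

Lemma ballot0 a : ballot a 0 = 1.
Proof. by rewrite /ballot addn0 bin0 bin_small. Qed.

Lemma ballotSS a b : ballot a.+1 b.+1 = ballot a b.+1 + ballot a.+1 b.
Proof. by rewrite /ballot !addSn !addnS !binS; lia. Qed.

(** Reflection principle; at [a = b] it forces [ballot a a.+1 = 0], the boundary value used
    below. *)
Lemma ballot_anti a b : ballot a b.+1 = - ballot b a.+1.
Proof. by rewrite /ballot opprB !addnS addnC. Qed.

Lemma ballot_ge0 a b : (b <= a.+1)%N -> 0 <= ballot a b.
Proof.
elim: a b => [|a IHa] b; first by case: b => [|[|b]].
elim: b => [|b IHb] le_b; first by rewrite ballot0.
have [<- | neq_b] := eqVneq b a.+1; first by have := ballot_anti b b; lia.
by rewrite ballotSS addr_ge0 ?IHa ?IHb //; lia.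
Qed.

Lemma ballot_le0 a b : (a < b)%N -> ballot a b <= 0.
Proof. by case: b => // b lt_ab; rewrite ballot_anti oppr_le0 ballot_ge0. Qed.

(** By [ballotSS], raising [a] by one adds a ballot number that is nonnegative in this range. *)
Lemma ballot_homo_l a a' b :
  (b <= a.+2)%N -> (a <= a')%N -> ballot a b <= ballot a' b.
Proof.
move=> le_b; elim: a' => [|a' IHa]; first by rewrite leqn0 => /eqP->.
rewrite leq_eqVlt => /orP[/eqP->//| lt_a]; apply: le_trans (IHa lt_a) _.
case: b le_b {IHa} => [|b] le_b; first by rewrite !ballot0.
by rewrite ballotSS lerDl ballot_ge0 //; lia.
Qed.

Definition catalan (t : nat) : int := ballot t t.

(** In [b] the values climb up to the diagonal [b = a] and are nonpositive beyond it. *)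
Lemma ballot_le_catalan a b : ballot a b <= catalan a.
Proof.
have [lt_ab | le_ba] := ltnP a b.
  by apply: le_trans (ballot_le0 lt_ab) (ballot_ge0 (leqnSn a)).
rewrite /catalan; move: (a - b)%N (subnKC le_ba) => d.
elim: d b {le_ba} => [|d IHd] b eq_a; first by rewrite -eq_a addn0.
apply: le_trans (_ : ballot a b.+1 <= _); last by apply: IHd; lia.
case: a {IHd} eq_a => [|a] eq_a; first lia.
by rewrite ballotSS lerDr ballot_ge0 //; lia.
Qed.

Lemma catalan_ge1 t : 1 <= catalan t.
Proof. by rewrite -(ballot0 t) ballot_le_catalan. Qed.

(** Since the recurrence has zero boundary values, [catalan t.+1 = catalan t + ballot t.+1 t.-1],
    and the last term is at least [ballot t t.-1 = catalan t]. At [t = 0] both Catalan numbers are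
    1. *)
Lemma catalan_double t : (0 < t)%N -> 2 * catalan t <= catalan t.+1.
Proof.
case: t => // t _; rewrite /catalan.
have E0 := ballotSS t.+1 t.+1; have E1 := ballotSS t.+1 t.
have Z1 := ballot_anti t.+1 t.+1; have E2 := ballotSS t t.
have Z2 := ballot_anti t t.
have le_t : ballot t.+1 t <= ballot t.+2 t by apply: ballot_homo_l; lia.
lia.
Qed.

(** The difference is [ballot (n - k.+1) k.+1]. *)
Lemma bin_diff_le_catalan n k :
  (k < n)%N -> 'C(n, k.+1)%:Z - 'C(n, k)%:Z <= catalan (n - k.+1).
Proof.
move=> lt_kn; have := ballot_le_catalan (n - k.+1) k.+1.
rewrite /ballot subnK //.
have -> : ((n - k.+1).+1 = n - k)%N by lia.
by rewrite bin_sub ?(ltnW lt_kn).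
Qed.

(** The difference is [ballot k (n - k)]; lowering [k] to [n - k] leaves [catalan (n - k)]. *)
Lemma catalan_le_bin_diff n k :
  (n <= k.*2)%N -> (k < n)%N ->
  catalan (n - k.+1) <= 'C(n, k)%:Z - 'C(n, k.+1)%:Z.
Proof.
move=> le_n lt_kn.
have le1 : catalan (n - k.+1) <= catalan (n - k).
  have -> : (n - k = (n - k.+1).+1)%N by lia.
  have [->|t0] := posnP (n - k.+1); first by [].
  have := catalan_ge1 (n - k.+1).
  by have := catalan_double t0; lia.
have le2 : catalan (n - k) <= ballot k (n - k) by apply: ballot_homo_l; lia.
apply: le_trans le1 (le_trans le2 _).
by rewrite /ballot subnKC ?bin_sub ?(ltnW lt_kn).
Qed.

(** * Invariants under a shift and under a cone *)

(** [good_0] spares [n = 0], where the empty set dominates. [good_down] bounds the ascents, so that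
    in a cone the binomial descent outweighs them. *)
Record good_sequence (n : nat) (p : nat -> nat) : Prop := GoodSequence {
  good_0 : (0 < n)%N -> p 0%N = 0%N;
  good_bin : forall k, (p k <= 'C(n, k))%N;
  good_up : forall k, (p k * (n - k) <= p k.+1 * k.+1)%N;
  good_down : forall k, (p k.+1)%:Z - (p k)%:Z <= catalan (n - k);
  good_unimodal : unimodal n (fun k => (p k)%:Z) }.

Lemma good_sequence_shift n p p' :
    p' 0%N = 0%N -> (forall k, p' k.+1 = p k) ->
  good_sequence n p -> good_sequence n.+1 p'.
Proof.
move=> p'0 p'S [p0 pbin pup pdown [j [le_j up down]]]; split=> //.
- case=> [|k]; rewrite ?p'0 // p'S binS.
  exact: leq_trans (pbin k) (leq_addl _ _).
- case=> [|k]; rewrite ?p'0 // !p'S subSS.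
  by apply: leq_trans (pup k) _; rewrite leq_mul2l leqnSn orbT.
- case=> [|k]; rewrite !p'S ?subSS ?p'0 ?subn0 //.
  by have := pbin 0%N; rewrite bin0; have := catalan_ge1 n.+1; lia.
exists j.+1; split=> // -[|i] lt_i; rewrite !p'S ?p'0 //.
- exact: up.
- exact: down.
Qed.

Lemma good_sequence_cone n p p' :
    (0 < n)%N -> p' 0%N = 0%N -> (forall k, p' k.+1 = p k.+1 + 'C(n, k))%N ->
  good_sequence n p -> good_sequence n.+1 p'.
Proof.
move=> n_gt0 p'0 p'S [/(_ n_gt0) p0 pbin pup pdown _].
have p_big k : (n < k)%N -> p k = 0%N.
  by move=> lt_k; have := pbin k; rewrite bin_small // leqn0 => /eqP.
have p'up k : (p' k * (n.+1 - k) <= p' k.+1 * k.+1)%N.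
  case: k => [|k]; first by rewrite p'0.
  (* The factor [n - k] exceeds that of [pup k.+1] by one; the extra [p k.+1] is absorbed by
     ['C(n, k.+1)]. *)
  rewrite !p'S subSS; have := pup k.+1; have := pbin k.+1.
  have := mul_bin_left n k.
  have [lt_kn|le_nk] := ltnP k n; last by nia.
  have : (n - k = (n - k.+1).+1)%N by lia.
  by nia.
have p'down k : (p' k.+1)%:Z - (p' k)%:Z <= catalan (n.+1 - k).
  case: k => [|k].
    have := pdown 0%N; rewrite p'S p'0 p0 bin0 !subn0.
    by have := catalan_double n_gt0; have := catalan_ge1 n; lia.
  rewrite !p'S subSS.
  have [lt_kn | le_nk] := ltnP k n; last first.
    have := catalan_ge1 (n - k).
    by rewrite (p_big k.+2) ?(bin_small (m := k.+1)) //; lia.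
  have := bin_diff_le_catalan lt_kn; have := pdown k.+1.
  have -> : (n - k = (n - k.+1).+1)%N by lia.
  (* Two bounds [catalan t] add up to at most [catalan t.+1], except at [t = 0]; there [p k.+2]
     vanishes and one bound suffices. *)
  have [t0 | t_gt0] := posnP (n - k.+1); last first.
    by have := catalan_double t_gt0; lia.
  rewrite t0 (p_big k.+2); last lia.
  have : catalan 0 <= catalan 1 by [].
  by lia.
split=> //.
- case=> [|k]; rewrite ?p'0 // p'S binS leq_add2r; exact: pbin.
(* As [2 i <= n], the factor [n.+1 - i] in [p'up] is at least [i.+1]. *)
have up i : (i < n./2.+1)%N -> (p' i)%:Z <= (p' i.+1)%:Z.
  by move=> lt_i; have := p'up i; nia.
have down i : (n./2.+1 < i)%N -> (i < n.+1)%N -> (p' i.+1)%:Z <= (p' i)%:Z.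
  case: i => // i lt_i le_i; rewrite !p'S.
  have := pdown i.+1; have : (n <= i.*2)%N by lia.
  by move=> /catalan_le_bin_diff/(_ le_i); lia.
(* Neither [up] nor [down] covers this step; its sign decides on which side of it the peak lies. *)
have [le_mid | lt_mid] := leqP (p' n./2.+1) (p' n./2.+2).
  exists n./2.+2; split=> //; first lia.
  by move=> i; rewrite ltnS leq_eqVlt => /predU1P[-> | /up].
exists n./2.+1; split=> //; first lia.
move=> i; rewrite leq_eqVlt => /predU1P[<- _ | /down//]; lia.
Qed.

(** * Dominating sets under the addition of a vertex *)

Section DominatingSubsets.
Variables (V : finType) (e : rel V).
Hypothesis e_sym : symmetric e.
Implicit Types (A S : {set V}) (x : V).

Definition dominates A S := [forall v in A, (v \in S) || [exists u in S, e v u]].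

(** Subsets [A] stand for induced subgraphs, so the vertex type stays fixed; the conjunction is
    nested to fit [card_subsetsU1]. *)
Definition num_dominating_in A k :=
  #|[set S : {set V} | (S \subset A) && (dominates A S && (#|S| == k))]|.

(** The first summand counts the sets containing [x], through the bijection that removes [x]. *)
Lemma card_subsetsU1 A x (P : pred {set V}) : x \notin A ->
  #|[set S : {set V} | (S \subset x |: A) && P S]| =
  (#|[set S : {set V} | (S \subset A) && P (x |: S)]| +
   #|[set S : {set V} | (S \subset A) && P S]|)%N.
Proof.
move=> xA; rewrite -(cardsID [set S : {set V} | x \in S]); congr (_ + _)%N.
  rewrite -[RHS](@card_in_imset _ _ (fun S => x |: S)); last first.
    move=> S1 S2; rewrite !inE => /andP[s1 _] /andP[s2 _] eqS.
    have x1 : x \notin S1 by apply: contra xA; apply: (subsetP s1).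
    have x2 : x \notin S2 by apply: contra xA; apply: (subsetP s2).
    by rewrite -(setU1K x1) eqS setU1K.
  apply: eq_card => S; rewrite !inE; apply/andP/imsetP.
    move=> [/andP[sS PS] xS]; exists (S :\ x); last by rewrite setD1K.
    by rewrite inE setD1K // PS andbT subDset.
  move=> [S' + ->]; rewrite inE => /andP[sS' PS'].
  by rewrite setU11 PS' setUS.
apply: eq_card => S; rewrite !inE andbA; congr andb.
have [xS | xS] /= := boolP (x \in S).
  by apply/esym/negbTE; apply: contra xA => /subsetP; apply.
by rewrite -{2}(setU1K xA) subsetD1 xS andbT.
Qed.

Lemma num_dominating_in0 k : num_dominating_in set0 k = (k == 0%N).
Proof.
rewrite /num_dominating_in; have [-> | k0] := eqVneq k 0%N.
  rewrite (_ : [set _ | _] = [set set0]) ?cards1 //.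
  apply/setP => S; rewrite !inE subset0 cards_eq0.
  case: eqP => //= ->; rewrite andbT.
  by apply/forall_inP => v; rewrite inE.
apply/eqP; rewrite cards_eq0; apply/eqP/setP => S; rewrite !inE subset0.
by case: eqP => //= ->; rewrite cards0 eq_sym (negbTE k0) andbF.
Qed.

Lemma num_dominating_in_size0 A : A != set0 -> num_dominating_in A 0 = 0%N.
Proof.
case/set0Pn=> x xA; apply/eqP; rewrite cards_eq0; apply/eqP/setP => S.
rewrite !inE cards_eq0; case: eqP => [->|_]; rewrite ?andbF // andbT.
apply/negbTE; rewrite negb_and; apply/orP; right.
apply/negP => /forall_inP/(_ x xA); rewrite inE /= => /exists_inP[u].
by rewrite inE.
Qed.

(** Only [x] dominates [x], and it dominates nothing in [A]. *)
Lemma num_dominating_in_isolated A x k :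
    x \notin A -> (forall y, y \in A -> ~~ e x y) ->
  num_dominating_in (x |: A) k.+1 = num_dominating_in A k.
Proof.
move=> xA iso; rewrite /num_dominating_in card_subsetsU1 // addnC.
rewrite [X in (X + _)%N]eq_card0 ?add0n => [|S]; last first.
  rewrite !inE; apply/negbTE; rewrite negb_and negb_and -implybE.
  apply/implyP => /subsetP sS; apply/orP; left.
  apply/negP => /forall_inP/(_ x (setU11 _ _))/orP[/sS|/exists_inP[u /sS uA]].
    by rewrite (negbTE xA).
  by rewrite (negbTE (iso u uA)).
apply: eq_card => S; rewrite !inE; case: (boolP (_ \subset _)) => //= sS.
have xS : x \notin S by apply: contra xA; apply: (subsetP sS).
rewrite cardsU1 xS eqSS; congr andb.
apply/forall_inP/forall_inP => dom v vA.
  have := dom v (setU1r _ vA); rewrite in_setU1.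
  have -> /= : (v == x) = false by apply: contraNF xA => /eqP<-.
  case/orP=> [->//|/exists_inP[u + evu]]; rewrite in_setU1.
  case/predU1P=> [eu | uS]; last by apply/orP; right; apply/exists_inP; exists u.
  by have := iso v vA; rewrite e_sym -eu evu.
case/setU1P: vA => [->|vA]; first by rewrite setU11.
case/orP: (dom v vA) => [vS | /exists_inP[u uS evu]]; first by rewrite setU1r.
by apply/orP; right; apply/exists_inP; exists u; rewrite // setU1r.
Qed.

(** Any set with [x] dominates, which gives the binomial. A set without [x] that dominates the
    nonempty [A] meets [A], hence dominates [x]. *)
Lemma num_dominating_in_cone A x k :
    x \notin A -> A != set0 -> (forall y, y \in A -> e x y) ->
  num_dominating_in (x |: A) k.+1 = (num_dominating_in A k.+1 + 'C(#|A|, k))%N.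
Proof.
move=> xA /set0Pn[y yA] adj; rewrite /num_dominating_in card_subsetsU1 // addnC.
rewrite -(cards_draws A k); congr (_ + _)%N; apply: eq_card => S; rewrite !inE;
  case: (boolP (_ \subset _)) => //= sS.
  congr andb; apply/forall_inP/forall_inP => dom v vA; first exact/dom/setU1r.
  case/setU1P: vA => [->|/dom//]; apply/orP; right; apply/exists_inP.
  have [yS | /exists_inP[u uS _]] := orP (dom y yA).
    by exists y; rewrite ?adj.
  by exists u; rewrite ?adj // (subsetP sS).
have xS : x \notin S by apply: contra xA; apply: (subsetP sS).
rewrite cardsU1 xS eqSS andb_idl // => _.
apply/forall_inP => v /setU1P[->|vA]; first by rewrite setU11.
by apply/orP; right; apply/exists_inP; exists x; rewrite ?setU11 // e_sym adj.
Qed.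

Lemma num_dominating_inT k : num_dominating_in setT k = num_dominating e k.
Proof.
apply: eq_card => S; rewrite !inE subsetT /=; congr andb.
by apply/forall_inP/forallP => dom v; [exact: dom | move=> _; exact: dom].
Qed.

(** * Induction along the threshold ordering *)

Lemma good_sequence_threshold :
  threshold e -> good_sequence #|V| (num_dominating e).
Proof.
case=> v [v_bij thr]; have v_inj := bij_inj v_bij.
pose A j := [set v i | i : 'I_#|V| & (i < j)%N].
have v_notin (j : 'I_#|V|) : v j \notin A j.
  by apply/imsetP => -[i]; rewrite inE => + /v_inj eq_ij; rewrite -eq_ij ltnn.
have A_S (j : 'I_#|V|) : A j.+1 = v j |: A j.
  apply/setP => y; apply/imsetP/setU1P => [[i + ->] | [-> | /imsetP[i + ->]]].
  - rewrite inE ltnS leq_eqVlt => /predU1P[/val_inj-> | lt_ij]; first by left.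
    by right; apply: imset_f; rewrite inE.
  - by exists j; rewrite // inE ltnSn.
  - by rewrite inE => lt_ij; exists i; rewrite // inE ltnW.
have A0 : A 0%N = set0.
  by apply/setP => y; rewrite inE; apply/imsetP => -[i]; rewrite inE.
have goodA j : (j <= #|V|)%N ->
    #|A j| = j /\ good_sequence j (num_dominating_in (A j)).
  elim: j => [|j IHj] lt_j.
    split; first by rewrite A0 cards0.
    rewrite A0; split=> //.
    - by move=> k; rewrite num_dominating_in0; case: k.
    - by move=> k; rewrite sub0n muln0.
    - move=> k; rewrite !num_dominating_in0.
      by have := catalan_ge1 (0 - k); case: eqP => //=; lia.
    - by exists 0%N.
  have [cardA goodA] := IHj (ltnW lt_j); pose oj := Ordinal lt_j.
  have ASj : A j.+1 = v oj |: A j := A_S oj.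
  split; first by rewrite ASj cardsU1 cardA (v_notin oj).
  have d0 : num_dominating_in (A j.+1) 0 = 0%N.
    apply: num_dominating_in_size0; rewrite ASj.
    by apply/set0Pn; exists (v oj); rewrite setU11.
  have isoP : (forall y, y \in A j -> ~~ e (v oj) y) ->
      good_sequence j.+1 (num_dominating_in (A j.+1)).
    move=> iso; apply: good_sequence_shift goodA => // k.
    by rewrite ASj num_dominating_in_isolated // (v_notin oj).
  have [iso | adj] := thr oj.
    apply: isoP => y /imsetP[i]; rewrite inE => lt_i ->; apply: iso.
    by apply: imset_f; rewrite inE ltnW.
  (* The first vertex is vacuously adjacent to all earlier ones, but the cone formula fails over the
     empty graph; it counts as isolated. *)
  have [j0 | j_gt0] := posnP j.
    by apply: isoP => y; rewrite j0 A0 inE.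
  apply: (good_sequence_cone j_gt0) goodA => // k.
  rewrite ASj num_dominating_in_cone ?cardA ?(v_notin oj) //.
    by rewrite -card_gt0 cardA.
  by move=> y /imsetP[i]; rewrite inE => lt_i ->; apply: adj.
have [cardT] := goodA _ (leqnn _).
have -> : A #|V| = setT by apply/eqP; rewrite eqEcard subsetT cardsT cardT /=.
case=> g0 gbin gup gdown [j [le_j up down]].
split=> [/g0|k|k|k|]; rewrite -?num_dominating_inT //.
exists j; split=> // i; rewrite -!num_dominating_inT; [exact: up | exact: down].
Qed.

End DominatingSubsets.

Theorem theorem19 (V : finType) (e : rel V)
    (e_sym : symmetric e) (e_irr : irreflexive e) (e_thr : threshold e) :
  unimodal #|V| (fun k => (domination_poly e)`_k).
Proof.
have coefD k : (k <= #|V|)%N -> (domination_poly e)`_k = (num_dominating e k)%:Z.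
  move=> le_k; rewrite /domination_poly.
  rewrite -(poly_def #|V|.+1 (fun k => (num_dominating e k)%:Z)).
  by rewrite coef_poly ltnS le_k.
have [j [le_j up down]] := good_unimodal (good_sequence_threshold e_sym e_thr).
exists j; split=> // [i lt_i | i le_i lt_i]; rewrite !coefD //; try lia.
- exact: up.
- exact: down.
Qed.
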